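(* Let $J^2$ be the twofold integration operator on $L^2([0,1])$, $[J^2x](s)=\int_0^s (s-t)\,x(t)\,dt$ for $0\le s\le 1$. The eigenvalues $\lambda$ of the operator $(J^2)^*J^2$ are exactly the solutions $\lambda>0$ of the nonlinear transcendental equation $$\cos\left(\frac{1}{\lambda^{1/4}}\right)\cdot\cosh\left(\frac{1}{\lambda^{1/4}}\right)+1=0.$$
   Context: $L^2([0,1])$ denotes the Hilbert space of real-valued square-integrable Lebesgue-measurable functions on $[0,1]$. $(J^2)^*$ is the Hilbert space adjoint, $[(J^2)^*z](t)=\int_t^1 (s-t)\,z(s)\,ds$ for $0\le t\le 1$. $\lambda^{1/4}$ is the positive real fourth root of $\lambda>0$. *)

(* Defs.v *)
From HB Require Import structures.
From mathcomp Require Import all_boot all_order all_algebra.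
From mathcomp Require Import all_classical all_reals all_analysis.
From mathcomp Require Import measurable_realfun.
From mathcomp Require Import lra.

Set Implicit Arguments.
Unset Strict Implicit.
Unset Printing Implicit Defensive.

Import Order.TTheory GRing.Theory Num.Theory.
Import numFieldNormedType.Exports.

Local Open Scope classical_set_scope.
Local Open Scope ring_scope.

(* Lebesgue measure on [0, 1], carried by the whole line: the complement of
   [0, 1] is null, so "a.e." for [mu01] only sees the values on [0, 1]. *)
Definition mu01 (R : realType) :
    {measure set (measurableTypeR R) -> \bar R} :=
  mrestr lebesgue_measure
    (measurable_itv `[0%R, 1%R]%R
      : measurable (`[0%R, 1%R]%classic : set (measurableTypeR R))).

(* Representatives of the elements of L^2([0, 1]); equality in the Hilbert
   space is [x = y %[ae mu01 R]].  Measurability is Borel measurability, which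
   loses no class, a Lebesgue-measurable function being a.e. equal to a Borel
   one. *)
Definition L2 (R : realType) := LfunType (mu01 R) (lee1n 2).

Definition L2_dot (R : realType) (x y : R -> R) : R :=
  \int[lebesgue_measure]_(t in `[0, 1]) (x t * y t).

Definition J2_fun (R : realType) (x : R -> R) (s : R) : R :=
  \int[lebesgue_measure]_(t in `[0, s]) ((s - t) * x t).

Definition J2adj_fun (R : realType) (z : R -> R) (t : R) : R :=
  \int[lebesgue_measure]_(s in `[t, 1]) ((s - t) * z s).

Section L2_operators.
Context {R : realType}.
Notation leb := (@lebesgue_measure R).
Implicit Types x y z : L2 R.

Lemma ae_mu01 (P : R -> Prop) : (forall t : R, t \in `[0, 1] -> P t) ->
  \forall t \ae mu01 R, P t.
Proof.
move=> IP; exists (~` `[0, 1]); split.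
- by apply: measurableC; exact: measurable_itv.
- by rewrite /mu01/= /mrestr setICl measure0.
- by move=> t /= nP /IP.
Qed.

Lemma integral_mu01 (D : set R) (f : R -> \bar R) : D `<=` `[0, 1] ->
  (\int[mu01 R]_(t in D) f t = \int[leb]_(t in D) f t)%E.
Proof.
move=> DI; apply: eq_measure_integral => A _ AD.
by rewrite /mu01/= /mrestr setIidl//; exact: subset_trans DI.
Qed.

Lemma mu01_fin : mu01 R setT \is a fin_num.
Proof.
by rewrite /mu01/= /mrestr setTI lebesgue_measure_itv/= lte01 EFinN sube0.
Qed.

Lemma L2_measurable x : measurable_fun setT (x : R -> R).
Proof. by have := LfunP x; rewrite inE => /andP[/set_mem]. Qed.

Lemma L2_integrable x : leb.-integrable `[0, 1] (EFin \o x).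
Proof.
have /Lfun1_integrable : (x : R -> R) \in Lfun (mu01 R) 1.
  by apply: (Lfun_subset12 mu01_fin); exact: LfunP.
move=> xT; have : (mu01 R).-integrable `[0, 1] (EFin \o x).
  by apply: integrableS xT.
by move=> /integrableP[mx xoo]; apply/integrableP; split;
  rewrite -?integral_mu01.
Qed.

Local Definition hat (x : R -> R) : R -> R := x \_ `[0, 1].

Local Lemma hat_measurable x : measurable_fun setT (hat x).
Proof.
apply/(measurable_restrictT _ _).1 => //.
by apply: measurable_funS (L2_measurable x).
Qed.

Local Lemma hat_integrable x : leb.-integrable setT (EFin \o hat x).
Proof.
rewrite (_ : EFin \o hat x = (EFin \o x) \_ `[0, 1]); last first.
  by rewrite restrict_EFin.
by apply/(integrable_mkcond _ _).1 => //; exact: L2_integrable.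
Qed.

Local Lemma kernel_measurable (x : R -> R) : measurable_fun setT x ->
  measurable_fun setT (fun p : R * R => Num.max (p.1 - p.2) 0 * x p.2).
Proof.
move=> mx; apply: measurable_funM; last exact: measurableT_comp.
by apply: measurable_maxr => //; exact: measurable_funB.
Qed.

Local Lemma measurable_param (f : R * R -> R) : measurable_fun setT f ->
  measurable_fun setT (fun s => \int[leb]_t f (s, t)).
Proof.
move=> mf; have mEf : measurable_fun setT (EFin \o f).
  exact/measurable_EFinP.
apply: measurableT_comp => //.
have -> : (fun s => \int[leb]_t (f (s, t))%:E)%E =
  (fun s => \int[leb]_t (EFin \o f)^\+ (s, t) -
            \int[leb]_t (EFin \o f)^\- (s, t))%E.
  apply/funext => s; rewrite integralE; congr (_ - _)%E;
  by apply: eq_integral => t _; rewrite ?(funeposE, funenegE).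
apply: emeasurable_funB.
- by apply: (measurable_fun_fubini_tonelli_F (m2 := leb)) => //;
    exact: measurable_funepos.
- by apply: (measurable_fun_fubini_tonelli_F (m2 := leb)) => //;
    exact: measurable_funeneg.
Qed.

Local Lemma max01 (s t : R) : 0 <= s <= 1 -> 0 <= t <= 1 ->
  0 <= Num.max (s - t) 0 <= 1.
Proof. by move=> ? ?; rewrite /Num.max; case: ifPn; lra. Qed.

Local Lemma J2_funE (x : R -> R) (s : R) : s <= 1 ->
  J2_fun x s = \int[leb]_t (Num.max (s - t) 0 * hat x t).
Proof.
move=> s1; rewrite /J2_fun Rintegral_mkcond; apply: eq_Rintegral => t _.
rewrite /hat !patchE !mem_setE !in_itv/= /Num.max.
case: ifPn => [ts|ts]; case: ifPn => [t1|t1]; case: ifPn => k;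
  rewrite ?mulr0 ?mul0r//; lra.
Qed.

Local Lemma J2adj_funE (z : R -> R) (t : R) : 0 <= t ->
  J2adj_fun z t = \int[leb]_s (Num.max (s - t) 0 * hat z s).
Proof.
move=> t0; rewrite /J2adj_fun Rintegral_mkcond.
apply: eq_Rintegral => s _.
rewrite /hat !patchE !mem_setE !in_itv/= /Num.max.
case: ifPn => [ts|ts]; case: ifPn => [t1|t1]; case: ifPn => k;
  rewrite ?mulr0 ?mul0r//; lra.
Qed.

Local Lemma J2_fun_measurable (x : R -> R) : measurable_fun setT x ->
  measurable_fun setT (J2_fun x).
Proof.
move=> mx; pose f (p : R * R) : R :=
  Num.max (p.1 - p.2) 0 * (x \_ `[0, +oo[) p.2.
rewrite (_ : J2_fun x = fun s => \int[leb]_t f (s, t)).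
  apply: measurable_param; apply: kernel_measurable.
  apply/(measurable_restrictT _ _).1 => //.
  exact: measurable_funS mx.
apply/funext => s; rewrite /J2_fun Rintegral_mkcond; apply: eq_Rintegral => t _.
rewrite /f !patchE !mem_setE !in_itv/= /Num.max andbT.
case: ifPn => [ts|ts]; case: ifPn => [t1|t1]; case: ifPn => k;
  rewrite ?mulr0 ?mul0r//; lra.
Qed.

Local Lemma J2adj_fun_measurable (z : R -> R) : measurable_fun setT z ->
  measurable_fun setT (J2adj_fun z).
Proof.
move=> mz; pose f (p : R * R) : R :=
  Num.max (p.2 - p.1) 0 * (z \_ `]-oo, 1]) p.2.
rewrite (_ : J2adj_fun z = fun t => \int[leb]_s f (t, s)).
  apply: measurable_param; apply: measurable_funM.
    by apply: measurable_maxr => //; exact: measurable_funB.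
  apply: measurableT_comp => //; apply/(measurable_restrictT _ _).1 => //.
  exact: measurable_funS mz.
apply/funext => t; rewrite /J2adj_fun Rintegral_mkcond.
apply: eq_Rintegral => s _.
rewrite /f !patchE !mem_setE !in_itv/= /Num.max.
case: ifPn => [ts|ts]; case: ifPn => [t1|t1]; case: ifPn => k;
  rewrite ?mulr0 ?mul0r//; lra.
Qed.

Local Lemma kernel_bound (k : R -> R) (x : L2 R) : measurable_fun setT k ->
  (forall t, 0 <= t <= 1 -> `|k t| <= 1) ->
  leb.-integrable setT (EFin \o (fun t => k t * hat x t)) /\
  `|\int[leb]_t (k t * hat x t)| <= \int[leb]_t `|hat x t|.
Proof.
move=> mk k1.
have le t : `|k t * hat x t| <= `|hat x t|.
  rewrite /hat patchE mem_setE in_itv/=; case: ifPn => [/k1 kt|_].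
    by rewrite normrM ler_piMl.
  by rewrite mulr0.
have ih : leb.-integrable setT (EFin \o (fun t => `|hat x t|)).
  by have := integrable_norm (hat_integrable x).
have ik : leb.-integrable setT (EFin \o (fun t => k t * hat x t)).
  apply: le_integrable (hat_integrable x) => //.
    by apply/measurable_EFinP/measurable_funM => //; exact: hat_measurable.
  by move=> t _ /=; rewrite lee_fin.
split => //; apply: le_trans (le_normr_Rintegral _ ik) _ => //.
apply: le_Rintegral => //.
by have := integrable_norm ik.
Qed.

Local Lemma bounded_L2 (f : R -> R) (c : R) : measurable_fun setT f ->
  (forall t, 0 <= t <= 1 -> `|f t| <= c) -> f \in Lfun (mu01 R) 2%:E.
Proof.
move=> mf fc; rewrite inE; apply/andP; split; rewrite inE//=.
rewrite /finite_norm unlock poweR_lty//.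
apply: (@le_lt_trans _ _ (\int[mu01 R]_t (cst (c `^ 2)%:E) t)%E); last first.
  rewrite integral_cst//= lte_mul_pinfty ?lee_fin ?powR_ge0//.
  by rewrite -ge0_fin_numE ?mu01_fin.
apply: ae_ge0_le_integral => //.
- by move=> t _; rewrite lee_fin powR_ge0.
- apply/measurable_EFinP.
  apply: (@measurableT_comp _ _ _ _ _ _ (fun x : R => x `^ 2)%R) => //.
  exact/measurableT_comp.
- by move=> t _; rewrite lee_fin powR_ge0.
- apply: ae_mu01 => t; rewrite in_itv/= => /fc ft _.
  by rewrite lee_fin ge0_ler_powR// nnegrE (le_trans _ ft).
Qed.

Local Lemma J2_sub x : J2_fun x \in Lfun (mu01 R) 2%:E.
Proof.
apply: (@bounded_L2 _ (\int[leb]_t `|hat x t|)).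
  by apply: J2_fun_measurable; exact: (L2_measurable x).
move=> s s01; rewrite J2_funE; last by case/andP: s01.
apply: (@kernel_bound (fun t => Num.max (s - t) 0) x _ _).2.
  by apply: measurable_maxr => //; exact: measurable_funB.
by move=> t t01; have /andP[? ?] := max01 s01 t01; rewrite ger0_norm.
Qed.

Local Lemma J2adj_sub z : J2adj_fun z \in Lfun (mu01 R) 2%:E.
Proof.
apply: (@bounded_L2 _ (\int[leb]_t `|hat z t|)).
  by apply: J2adj_fun_measurable; exact: (L2_measurable z).
move=> t t01; rewrite J2adj_funE; last by case/andP: t01.
apply: (@kernel_bound (fun s => Num.max (s - t) 0) z _ _).2.
  by apply: measurable_maxr => //; exact: measurable_funB.
by move=> s s01; have /andP[? ?] := max01 s01 t01; rewrite ger0_norm.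
Qed.

Definition J2 x : L2 R := Lfun_Sub (lee1n 2) (J2_sub x).

Definition J2adj z : L2 R := Lfun_Sub (lee1n 2) (J2adj_sub z).

Local Definition h x z (p : R * R) : R :=
  Num.max (p.1 - p.2) 0 * hat x p.2 * hat z p.1.

Local Lemma hat0 (y : R -> R) t : t \notin `[0, 1] -> hat y t = 0.
Proof. by move=> tI; rewrite /hat patchE mem_setE (negbTE tI). Qed.

Local Lemma hat1 (y : R -> R) t : t \in `[0, 1] -> hat y t = y t.
Proof. by move=> tI; rewrite /hat patchE mem_setE tI. Qed.

Local Lemma h_measurable x z : measurable_fun setT (h x z).
Proof.
apply: measurable_funM.
  by apply: kernel_measurable; exact: hat_measurable.
by apply: measurableT_comp => //; exact: hat_measurable.
Qed.

Local Lemma h_le x z p : `|h x z p| <= `|hat z p.1| * `|hat x p.2|.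
Proof.
rewrite /h -mulrA -normrM [X in _ <= `|X|]mulrC [leLHS]normrM.
have [p2|p2] := boolP (p.2 \in `[0, 1]);
  last by rewrite (hat0 _ p2) !(normr0, mulr0, mul0r).
have [p1|p1] := boolP (p.1 \in `[0, 1]);
  last by rewrite (hat0 _ p1) !(normr0, mulr0, mul0r).
rewrite ler_piMl//.
move: p1 p2; rewrite !in_itv/= => p1 p2.
by have /andP[? ?] := max01 p1 p2; rewrite ger0_norm.
Qed.

Local Lemma h_integrable1 x z s :
  leb.-integrable setT (fun t => (h x z (s, t))%:E).
Proof.
apply: le_integrable (integrableZl _ `|hat z s| (hat_integrable x)) => //.
- by apply/measurable_EFinP; apply: (measurableT_comp (h_measurable x z));
  exact: pair1_measurable.
- by move=> t _; rewrite -EFinM lee_fin normrM normr_id; exact: h_le.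
Qed.

Local Lemma h_integrable2 x z t :
  leb.-integrable setT (fun s => (h x z (s, t))%:E).
Proof.
apply: le_integrable (integrableZl _ `|hat x t| (hat_integrable z)) => //.
- by apply/measurable_EFinP; apply: (measurableT_comp (h_measurable x z));
  exact: pair2_measurable.
- by move=> s _; rewrite -EFinM lee_fin normrM normr_id mulrC; exact: h_le.
Qed.

Local Lemma h_integrable x z : (leb \x leb)%E.-integrable setT (EFin \o h x z).
Proof.
apply/integrable12ltyP; first by apply/measurable_EFinP; exact: h_measurable.
have xoo : (\int[leb]_t `|(hat x t)%:E| < +oo)%E.
  by have /integrableP[] := hat_integrable x.
have x0 : (0 <= \int[leb]_t `|(hat x t)%:E|)%E by exact: integral_ge0.
have /integrableP[mz zoo] := hat_integrable z.
apply: (@le_lt_trans _ _ (\int[leb]_s (`|(hat z s)%:E| *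
    \int[leb]_t `|(hat x t)%:E|))%E).
  apply: ge0_le_integral => //.
  - by move=> s _; exact: integral_ge0.
  - apply: (measurable_fun_fubini_tonelli_F (m2 := leb)
      (abse \o (EFin \o h x z))) => //.
    + by apply: measurableT_comp => //;
      apply/measurable_EFinP; exact: h_measurable.
    + by move=> p; exact: abse_ge0.
  - by apply: emeasurable_funM => //; exact: measurableT_comp.
  - move=> s _; rewrite -ge0_integralZl//; last first.
      by apply: measurableT_comp => //;
      apply/measurable_EFinP; exact: hat_measurable.
    apply: ge0_le_integral => //.
    + apply: measurableT_comp => //.
      by have /integrableP[] := h_integrable1 x z s.
    + apply: emeasurable_funM => //; apply: measurableT_comp => //;
      apply/measurable_EFinP; exact: hat_measurable.
    + by move=> t _; rewrite -EFinM lee_fin; exact: h_le.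
rewrite ge0_integralZr//; last exact: measurableT_comp.
by rewrite lte_mul_pinfty// ?ge0_fin_numE ?integral_ge0.
Qed.

(* [J2adj] is the Hilbert-space adjoint of [J2]. *)
Lemma J2adjP x z : L2_dot (J2 x) z = L2_dot x (J2adj z).
Proof.
have -> : L2_dot (J2 x) z = \int[leb]_s \int[leb]_t h x z (s, t).
  rewrite /L2_dot Rintegral_mkcond; apply: eq_Rintegral => s _.
  rewrite patchE mem_setE; case: ifPn => sI; last first.
    under eq_Rintegral do rewrite /h /= (hat0 _ sI) mulr0.
    by rewrite Rintegral_cst// mul0r.
  move: (sI); rewrite in_itv/= => /[dup] s01 /andP[_ s1].
  rewrite /h /= RintegralZr//; first by rewrite hat1// -J2_funE.
  apply: (@kernel_bound (fun t => Num.max (s - t) 0) x _ _).1.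
    by apply: measurable_maxr => //; exact: measurable_funB.
  by move=> t t01; have /andP[? ?] := max01 s01 t01; rewrite ger0_norm.
have -> : L2_dot x (J2adj z) = \int[leb]_t \int[leb]_s h x z (s, t).
  rewrite /L2_dot Rintegral_mkcond; apply: eq_Rintegral => t _.
  rewrite patchE mem_setE; case: ifPn => tI; last first.
    under eq_Rintegral do rewrite /h /= (hat0 _ tI) mulr0 mul0r.
    by rewrite Rintegral_cst// mul0r.
  move: (tI); rewrite in_itv/= => /[dup] t01 /andP[t0 _].
  rewrite /h /=; under eq_Rintegral do rewrite mulrAC.
  rewrite RintegralZr//; first by rewrite hat1// -J2adj_funE// mulrC.
  apply: (@kernel_bound (fun s => Num.max (s - t) 0) z _ _).1.
    by apply: measurable_maxr => //; exact: measurable_funB.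
  by move=> s s01; have /andP[? ?] := max01 s01 t01; rewrite ger0_norm.
rewrite {1 3}/Rintegral; congr fine.
under eq_integral do
  rewrite fineK ?(integrable_fin_num _ (h_integrable1 _ _ _))//.
under [RHS]eq_integral do
  rewrite fineK ?(integrable_fin_num _ (h_integrable2 _ _ _))//.
exact: (Fubini (h_integrable x z)).
Qed.

Local Lemma ae_itv x y (D : set R) (k : R -> R) :
  measurable D -> D `<=` `[0, 1] ->
  measurable_fun setT k -> x = y %[ae mu01 R] ->
  \int[leb]_(t in D) (k t * x t) = \int[leb]_(t in D) (k t * y t).
Proof.
move=> mD DI mk [N [mN N0 xyN]]; congr fine; apply: ae_eq_integral => //.
- apply/measurable_EFinP/measurable_funM; first exact: measurable_funS mk.
  exact: measurable_funS (L2_measurable x).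
- apply/measurable_EFinP/measurable_funM; first exact: measurable_funS mk.
  exact: measurable_funS (L2_measurable y).
exists (N `&` `[0, 1]); split => //; first by apply: measurableI.
move=> t /= /not_implyP[Dt xyt]; split; last exact: DI.
by apply: xyN => /= /(_ I) xy; apply: xyt; rewrite xy.
Qed.

(* [J2] and [J2adj] depend only on the a.e. class of their argument. *)
Lemma J2_ae x y : x = y %[ae mu01 R] -> J2 x = J2 y %[ae mu01 R].
Proof.
move=> xy; apply: ae_mu01 => s; rewrite in_itv/= => /andP[s0 s1] _ /=.
apply: ae_itv xy => //; last exact: measurable_funB.
by move=> t /=; rewrite !in_itv/= => /andP[-> /le_trans->].
Qed.

Lemma J2adj_ae x y : x = y %[ae mu01 R] -> J2adj x = J2adj y %[ae mu01 R].
Proof.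
move=> xy; apply: ae_mu01 => t; rewrite in_itv/= => /andP[t0 t1] _ /=.
apply: ae_itv xy => //; last exact: measurable_funB.
by move=> s /=; rewrite !in_itv/= => /andP[/(le_trans t0)-> ->].
Qed.

End L2_operators.

Definition L2_eigenvalue (R : realType) (T : L2 R -> L2 R) (lambda : R) :=
  exists2 x : L2 R, ~ (x = 0 %[ae mu01 R]) &
    T x = (lambda *: x : L2 R) %[ae mu01 R].

Definition cosh (R : realType) (u : R) : R := (expR u + expR (- u)) / 2.

(* Main.v *)
Require Import Defs.
From mathcomp Require Import all_boot all_order all_algebra.
From mathcomp Require Import all_classical all_reals all_analysis.
From mathcomp Require Import measurable_realfun.
From mathcomp Require Import ring lra.
Set Implicit Arguments.
Unset Strict Implicit.
Unset Printing Implicit Defensive.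
Import Order.TTheory GRing.Theory Num.Theory.
Import numFieldNormedType.Exports.
Local Open Scope classical_set_scope.
Local Open Scope ring_scope.

(** The twofold integrations are inverse to the second derivative, so an
eigenfunction of [(J^2)^* J^2] for [lambda = u ^- 4] is a solution of the
vibrating beam equation [w^(4) = u^4 w] on [[0, 1]].  The starting point of
each integration gives the boundary conditions: [J^2] starts at 0 and makes the
second and third derivatives vanish there (free end), its adjoint starts at 1
and makes the value and the slope vanish there (clamped end).  The equation in
the statement is the classical frequency equation of this cantilever beam.

The operator is positive: [lambda <x, x> = <J^2 x, J^2 x>], and [J^2] is
injective ([J2_inj]), so every eigenvalue is positive ([L2_eigenvalue_gt0]).

An eigenfunction [x] is only square integrable.  Since [lambda x] is a.e. equal
to the continuous function [J2adj (J2 x)], it has a continuous representative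
[y]; four successive antiderivatives of [y] then satisfy the beam equation
everywhere on [[0, 1]].  Instead of a uniqueness theorem for differential
equations, the proof uses Green's identity ([green_identity]): pairing [w] with
a solution [g] of the same equation gives a quantity that is constant along the
beam, and taking for [g] the two solutions with suitable vanishing data at [s]
yields [w s] and its slope explicitly in terms of those at 0
([beam_solution], [beam_solution_slope]).  At [s = 1] the clamped conditions
become a homogeneous linear system of size 2, whose determinant is
[2 (cos u cosh u + 1)] ([beam_det]).  Conversely, when the determinant vanishes
the kernel vector of the system gives an explicit eigenfunction
([beam_equation_eigenvalue]). *)

(** * Solutions of the beam equation *)

Definition sinh (R : realType) (u : R) : R := (expR u - expR (- u)) / 2.

Section beam_functions.
Context {R : realType}.
Implicit Types (u t s : R).

(** Twice the Krylov functions: a basis of the solutions of [f^(4) = f] that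
differentiation permutes cyclically, A -> E -> C -> B -> A, and whose values at 0
vanish except for that of A.  They play for this equation the role of the Taylor
monomials. *)
Definition beamA u := cosh u + cos u.
Definition beamB u : R := sinh u + sin u.
Definition beamC u := cosh u - cos u.
Definition beamE u : R := sinh u - sin u.

Lemma is_derive_conv (f : R -> R) t (d d' : R) :
  is_derive t 1 f d -> d = d' -> is_derive t 1 f d'.
Proof. by move=> fd <-. Qed.

Lemma is_derive_expRN u : is_derive u 1 (fun v => expR (- v)) (- expR (- u)).
Proof.
have := @is_derive1_comp R expR -%R u _ _ (is_derive_expR _) (is_deriveNid _ _).
by rewrite mulrN1.
Qed.

Lemma is_derive_cosh u : is_derive u 1 (@cosh R) (sinh u).
Proof.
have ? := is_derive_expRN u.
rewrite (_ : @cosh R = 2^-1 *: (expR + (fun v => expR (- v)))); last first.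
  by apply/funext => v; rewrite /cosh !fctE mulrC.
by apply: is_derive_eq; rewrite /sinh mulrC.
Qed.

Lemma is_derive_sinh u : is_derive u 1 (@sinh R) (cosh u).
Proof.
have ? := is_derive_expRN u.
rewrite (_ : @sinh R = 2^-1 *: (expR - (fun v => expR (- v)))); last first.
  by apply/funext => v; rewrite /sinh !fctE mulrC.
by apply: is_derive_eq; rewrite /cosh opprK mulrC.
Qed.

Lemma is_derive_beamA u : is_derive u 1 beamA (beamE u).
Proof. by have := is_derive_cosh u => ?; apply: is_deriveD. Qed.

Lemma is_derive_beamE u : is_derive u 1 beamE (beamC u).
Proof. by have := is_derive_sinh u => ?; apply: is_deriveB. Qed.

Lemma is_derive_beamC u : is_derive u 1 beamC (beamB u).
Proof.
have := @is_deriveB _ _ _ _ _ u 1 _ _ (is_derive_cosh u) (is_derive_cos u).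
by rewrite opprK.
Qed.

Lemma is_derive_beamB u : is_derive u 1 beamB (beamA u).
Proof. by have := is_derive_sinh u => ?; apply: is_deriveD. Qed.

Lemma beam0 : ((beamA 0 = 2) * (beamB 0 = 0) * (beamC 0 = 0) * (beamE 0 = 0))%type.
Proof.
rewrite /beamA /beamB /beamC /beamE /cosh /sinh oppr0 expR0 cos0 sin0.
by do !split; lra.
Qed.

(** This is the determinant of the clamped conditions at the end 1, see
[beam_characteristic]. *)
Lemma beam_det u : beamA u ^+ 2 - beamB u * beamE u = 2 * (cos u * cosh u + 1).
Proof.
have := cos2Dsin2 u.
have := expRxMexpNx_1 u.
rewrite /beamA /beamB /beamE /cosh /sinh.
move: (expR u) (expR (- u)) (cos u) (sin u) => p q c d pq cd.
transitivity (p * q + (c ^+ 2 + d ^+ 2) + c * (p + q)); first by field.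
by rewrite pq cd; field.
Qed.

(** [cosh u > 1] for nonzero [u]: by the arithmetic-geometric inequality for
[expR u] and [expR (- u)], which are distinct with product 1. *)
Lemma beamA_gt0 u : u != 0 -> 0 < beamA u.
Proof.
move=> u0.
have := expRxMexpNx_1 u; have := expR_gt0 u; have := expR_gt0 (- u).
have : expR u != 1 by rewrite -expR0 (inj_eq (@expR_inj R)).
have := cos_geN1 u.
rewrite /beamA /cosh.
move: (expR u) (expR (- u)) (cos u) => p q c c1 p1 q0 p0 pq.
have := sqr_ge0 (p - 1).
rewrite le_eqVlt eq_sym sqrf_eq0 subr_eq0 (negbTE p1)/= => p2.
have : 0 < (p - 1)^+2 * q by rewrite mulr_gt0.
rewrite (_ : (p - 1)^+2 * q = p * (p * q) - 2 * (p * q) + q); last ring.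
by rewrite pq; lra.
Qed.

Lemma is_derive_affine (f : R -> R) (df u s t : R) :
  is_derive (u * (s - t)) 1 f df ->
  is_derive t 1 (fun t => f (u * (s - t))) (- (u * df)).
Proof.
move=> fd.
have d : is_derive t 1 (fun t => u * (s - t)) (- u).
  rewrite (_ : (fun t => _) = u *: (cst s - id)); last by apply/funext.
  by apply: is_derive_eq; rewrite sub0r -[_ *: _]/(_ * _) mulrN1.
have := @is_derive1_comp R f _ t _ _ fd d.
by rewrite mulrN mulrC.
Qed.
End beam_functions.

(** * Twofold integration of continuous functions *)

Section twofold_integration.
Context {R : realType}.
Notation leb := (@lebesgue_measure R).

Lemma is_derive_continuous (f df : R -> R) :
  (forall t, is_derive t (1 : R) f (df t)) -> continuous f.
Proof.
move=> fd t; apply/differentiable_continuous/derivable1_diffP.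
by have [] := fd t.
Qed.

Lemma Rintegral_primitive (f F : R -> R) (a b : R) : a <= b ->
  continuous f -> (forall t, is_derive t (1 : R) F (f t)) ->
  \int[leb]_(t in `[a, b]) f t = F b - F a.
Proof.
rewrite le_eqVlt => /predU1P[<- _ _|ab cf Ff].
  by rewrite set_itv1 Rintegral_set1 subrr.
have cF := is_derive_continuous Ff.
rewrite /Rintegral (@continuous_FTC2 _ f F _ _ ab)//.
- exact: continuous_subspaceT.
- split; first by move=> t _; have [] := Ff t.
    by apply: cvg_at_right_filter; exact: cF.
  by apply: cvg_at_left_filter; exact: cF.
- by move=> t _; rewrite derive1E; have [_ ->] := Ff t.
Qed.

(** The integrand [(s - t) * x t] is the derivative of [(s - t) * dz t + z t]; the
initial conditions at 0 cancel the lower boundary term. *)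
Lemma J2_fun_primitive (x z dz : R -> R) (s : R) :
  continuous x -> (forall t, is_derive t (1 : R) z (dz t)) ->
  (forall t, is_derive t (1 : R) dz (x t)) -> z 0 = 0 -> dz 0 = 0 -> 0 <= s ->
  J2_fun x s = z s.
Proof.
move=> cx zd dzd z0 dz0 s0.
have d t : is_derive t (1 : R) (fun t => (s - t) * dz t + z t) ((s - t) * x t).
  have := zd t; have := dzd t => ? ?.
  rewrite (_ : (fun t => _) = (cst s - id) * dz + z); last by apply/funext.
  by apply: is_derive_eq; rewrite !fctE /GRing.scale/=; ring.
rewrite /J2_fun (Rintegral_primitive s0 _ d).
  by rewrite z0 dz0; ring.
move=> t; apply: cvgM; last exact: cx.
by apply: cvgB; [exact: cvg_cst|exact: cvg_id].
Qed.

(** As in [J2_fun_primitive], with the antiderivative [(s - t) * dw s - w s] and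
the conditions now at the end 1. *)
Lemma J2adj_fun_primitive (z w dw : R -> R) (t : R) :
  continuous z -> (forall t, is_derive t (1 : R) w (dw t)) ->
  (forall t, is_derive t (1 : R) dw (z t)) -> w 1 = 0 -> dw 1 = 0 -> t <= 1 ->
  J2adj_fun z t = w t.
Proof.
move=> cz wd dwd w1 dw1 t1.
have d s : is_derive s (1 : R) (fun s => (s - t) * dw s - w s) ((s - t) * z s).
  have := wd s; have := dwd s => ? ?.
  rewrite (_ : (fun s => _) = (id - cst t) * dw - w); last by apply/funext.
  by apply: is_derive_eq; rewrite !fctE /GRing.scale/=; ring.
rewrite /J2adj_fun (Rintegral_primitive t1 _ d).
  by rewrite w1 dw1; ring.
move=> s; apply: cvgM; last exact: cz.
by apply: cvgB; [exact: cvg_id|exact: cvg_cst].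
Qed.

End twofold_integration.

Section antiderivative.
Context {R : realType}.
Notation leb := (@lebesgue_measure R).

Lemma primitive_of_eq0_left (f : R -> R) : continuous f ->
  (forall t, t <= 0 -> f t = 0) ->
  exists F : R -> R, forall t, is_derive t (1 : R) F (f t).
Proof.
move=> cf f0; exists (fun x => \int[leb]_(t in `]-oo, x]) f t) => t.
have fint : leb.-integrable `]-oo, t + 1] (EFin \o f).
  apply/(integrable_mkcond _ _).2 => //.
  rewrite (_ : _ \_ _ = (EFin \o f) \_ `[0, t + 1]).
    apply/(integrable_mkcond _ _).1 => //.
    apply: continuous_compact_integrable; first exact: segment_compact.
    exact: continuous_subspaceT.
  apply/funext => s; rewrite !patchE !mem_setE !in_itv/=.
  by case: (leP 0 s) => //= /ltW/f0 ->; case: ifP.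
have tt1 : t < t + 1 by rewrite ltrDl.
have [dF <-] := continuous_FTC1 tt1 fint (ltNyr t) (cf t).
by rewrite derive1E; exact: derivableP.
Qed.

(** The two halves [f (max t 0) - f 0] and [f (min t 0) - f 0] of [f] vanish on
one side of 0, where an integral from infinity makes sense; they add up to
[f t - f 0].  An antiderivative on the whole line keeps the derivatives at 0 and
1 two-sided in what follows. *)
Lemma continuous_primitive (f : R -> R) : continuous f ->
  exists F : R -> R, forall t, is_derive t (1 : R) F (f t).
Proof.
move=> cf.
have [P dP] : exists P : R -> R,
    forall t, is_derive t (1 : R) P (f (Num.max t 0) - f 0).
  apply: (@primitive_of_eq0_left (fun t => f (Num.max t 0) - f 0)).
    move=> t; apply: cvgB; last exact: cvg_cst.
    apply: continuous_comp; last exact: cf.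
    by apply: continuous_max; [exact: cvg_id|exact: cvg_cst].
  by move=> t t0; rewrite max_r// subrr.
have [N dN] : exists N : R -> R,
    forall t, is_derive t (1 : R) N (f (Num.min (- t) 0) - f 0).
  apply: (@primitive_of_eq0_left (fun t => f (Num.min (- t) 0) - f 0)).
    move=> t; apply: cvgB; last exact: cvg_cst.
    apply: (@continuous_comp _ _ _ (fun t : R => Num.min (- t) 0) f);
      last exact: cf.
    by apply: continuous_min; [exact: opp_continuous|exact: cvg_cst].
  by move=> t t0; rewrite min_r ?subrr// oppr_ge0.
have [M dM] : exists M : R -> R,
    forall t, is_derive t (1 : R) M (f (Num.min t 0) - f 0).
  exists (- (N \o -%R)) => t.
  have := @is_derive1_comp R N -%R t _ _ (dN (- t)) (is_deriveNid _ _).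
  by move=> /is_deriveN; rewrite mulrN1 !opprK.
exists (P + M + f 0 *: id) => t.
have dI : is_derive t (1 : R) (f 0 *: id) (f 0 *: 1) by exact: is_deriveZ.
apply: (is_derive_conv (is_deriveD (is_deriveD (dP t) (dM t)) dI)).
have -> : (f 0 *: 1 : R) = f 0 by exact: mulr1.
by case: (leP 0 t) => t0; ring.
Qed.

End antiderivative.

(** * Green's identity and the frequency equation *)

Section beam_equation.
Context {R : realType}.

(** The derivative of the bilinear quantity telescopes to
[(y - k * w) * g], which vanishes where [y = k * w]. *)
Lemma green_identity (k : R) (w w1 z z1 y g g1 g2 g3 : R -> R) (s : R) :
  0 <= s ->
  (forall t, 0 <= t <= s -> y t = k * w t) ->
  (forall t, is_derive t (1 : R) w (w1 t)) ->
  (forall t, is_derive t (1 : R) w1 (z t)) ->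
  (forall t, is_derive t (1 : R) z (z1 t)) ->
  (forall t, is_derive t (1 : R) z1 (y t)) ->
  (forall t, is_derive t (1 : R) g (g1 t)) ->
  (forall t, is_derive t (1 : R) g1 (g2 t)) ->
  (forall t, is_derive t (1 : R) g2 (g3 t)) ->
  (forall t, is_derive t (1 : R) g3 (k * g t)) ->
  z1 s * g s - z s * g1 s + w1 s * g2 s - w s * g3 s =
  z1 0 * g 0 - z 0 * g1 0 + w1 0 * g2 0 - w 0 * g3 0.
Proof.
move=> s0 yw dw dw1 dz dz1 dg dg1 dg2 dg3.
pose W := z1 * g - z * g1 + w1 * g2 - w * g3.
have dW t : is_derive t (1 : R) W ((y t - k * w t) * g t).
  have ? := dw t; have ? := dw1 t; have ? := dz t; have ? := dz1 t.
  have ? := dg t; have ? := dg1 t; have ? := dg2 t; have ? := dg3 t.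
  rewrite /W.
  by apply: is_derive_eq; rewrite /GRing.scale/=; ring.
have [|c c0s /eqP] := MVT_segment s0 (fun t _ => dW t).
  exact/continuous_subspaceT/is_derive_continuous.
move: c0s; rewrite in_itv/= => /yw ->.
by rewrite subrr !mul0r subr_eq0 => /eqP.
Qed.

(** Here [w] is a beam deflection, with slope [w1], curvature [z] and
shear [z1]; the end at 0 is free. *)
Section free_end.
Context (u : R) (w w1 z z1 y : R -> R) (u0 : u != 0)
  (yw : forall t, 0 <= t <= 1 -> y t = u ^+ 4 * w t)
  (dw : forall t, is_derive t (1 : R) w (w1 t))
  (dw1 : forall t, is_derive t (1 : R) w1 (z t))
  (dz : forall t, is_derive t (1 : R) z (z1 t))
  (dz1 : forall t, is_derive t (1 : R) z1 (y t))
  (z0 : z 0 = 0) (z10 : z1 0 = 0).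

(** Green's identity for the comparison solution [g t = f (u * (s - t))], where
[f] satisfies [f^(4) = f]: the values of [f] at 0 select which derivative of
[w] at [s] survives on the left. *)
Lemma beam_green (f f1 f2 f3 : R -> R) (s : R) : 0 <= s <= 1 ->
  (forall v, is_derive v (1 : R) f (f1 v)) ->
  (forall v, is_derive v (1 : R) f1 (f2 v)) ->
  (forall v, is_derive v (1 : R) f2 (f3 v)) ->
  (forall v, is_derive v (1 : R) f3 (f v)) ->
  z1 s * f 0 + u * z s * f1 0 + u ^+ 2 * w1 s * f2 0 + u ^+ 3 * w s * f3 0 =
  u ^+ 2 * w1 0 * f2 (u * s) + u ^+ 3 * w 0 * f3 (u * s).
Proof.
move=> /andP[s0 s1] fd f1d f2d f3d.
pose G (h : R -> R) (t : R) := h (u * (s - t)).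
have ywS t : 0 <= t <= s -> y t = u ^+ 4 * w t.
  by move=> /andP[t0 ts]; apply: yw; rewrite t0 (le_trans ts).
have d (c c' : R) (h dh : R -> R) t :
    (forall v, is_derive v (1 : R) h (dh v)) -> - (c * u) = c' ->
    is_derive t (1 : R) (c *: G h) (c' * G dh t).
  move=> hd <-; have := is_derive_affine (hd (u * (s - t))) => ?.
  by apply: is_derive_eq; rewrite /GRing.scale/= /G; ring.
have d1 t : is_derive t (1 : R) (1 *: G f) ((- u *: G f1) t).
  by apply: d fd _; ring.
have d2 t : is_derive t (1 : R) (- u *: G f1) ((u ^+ 2 *: G f2) t).
  by apply: d f1d _; ring.
have d3 t : is_derive t (1 : R) (u ^+ 2 *: G f2) ((- u ^+ 3 *: G f3) t).
  by apply: d f2d _; ring.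
have d4 t : is_derive t (1 : R) (- u ^+ 3 *: G f3) (u ^+ 4 * (1 *: G f) t).
  by rewrite scale1r; apply: d f3d _; ring.
have := green_identity s0 ywS dw dw1 dz dz1 d1 d2 d3 d4.
rewrite !fctE /G subrr mulr0 subr0 z0 z10 /GRing.scale/=.
by lra.
Qed.

(** The choice [f = beamE] leaves only [w s], because [beamA] is the only one of
the four functions that does not vanish at 0. *)
Lemma beam_solution (s : R) : 0 <= s <= 1 ->
  2 * u * w s = w1 0 * beamB (u * s) + u * w 0 * beamA (u * s).
Proof.
move=> s01; apply: (@mulfI _ (u ^+ 2)); first by rewrite expf_neq0.
have := beam_green s01 is_derive_beamE is_derive_beamC is_derive_beamB
  is_derive_beamA.
by rewrite !beam0; lra.
Qed.

(** The choice [f = beamC] leaves only the slope. *)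
Lemma beam_solution_slope (s : R) : 0 <= s <= 1 ->
  2 * w1 s = w1 0 * beamA (u * s) + u * w 0 * beamE (u * s).
Proof.
move=> s01; apply: (@mulfI _ (u ^+ 2)); first by rewrite expf_neq0.
have := beam_green s01 is_derive_beamC is_derive_beamB is_derive_beamA
  is_derive_beamE.
by rewrite !beam0; lra.
Qed.

(** [beam_solution] and [beam_solution_slope] at [s = 1] are a homogeneous linear
system for [u * w 0] and [w1 0], with determinant given by [beam_det]. *)
Lemma beam_characteristic : w 1 = 0 -> w1 1 = 0 -> w 0 != 0 \/ w1 0 != 0 ->
  cos u * cosh u + 1 = 0.
Proof.
move=> w1_0 w11_0 nz.
have i01 : 0 <= (1 : R) <= 1 by rewrite ler01 lexx.
have := beam_solution i01; have := beam_solution_slope i01.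
rewrite w1_0 w11_0 !mulr1 !mulr0.
have : u * w 0 != 0 \/ w1 0 != 0.
  by case: nz => nz; [left; rewrite mulf_neq0|right].
have := beam_det u.
move: (beamA u) (beamB u) (beamE u) (cos u * cosh u + 1) (u * w 0) (w1 0).
move=> A B E D Q P dt nzQP e1 e2.
(* Cramer's rule, for each unknown. *)
have DQ : D * (2 * Q) = 0.
  transitivity ((A ^+ 2 - B * E) * Q); first by rewrite dt; ring.
  transitivity (A * (P * B + Q * A) - B * (P * A + Q * E)); first by ring.
  by rewrite -e1 -e2; ring.
have DP : D * (2 * P) = 0.
  transitivity ((A ^+ 2 - B * E) * P); first by rewrite dt; ring.
  transitivity (A * (P * A + Q * E) - E * (P * B + Q * A)); first by ring.
  by rewrite -e1 -e2; ring.
have [//|D0] := eqVneq D 0.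
move: DQ DP => /eqP + /eqP; rewrite !mulf_eq0 (negbTE D0) pnatr_eq0/=.
by move=> /eqP Q0 /eqP P0; case: nzQP => /eqP.
Qed.
End free_end.
End beam_equation.

(** * The eigenfunction of a solution of the frequency equation *)

Section existence.
Context {R : realType}.

Definition comb (k a b u : R) (f g : R -> R) (t : R) :=
  k * (a * f (u * t) + b * g (u * t)).

Lemma is_derive_comb (k k' a b u t : R) (f g df dg : R -> R) :
  (forall v, is_derive v (1 : R) f (df v)) ->
  (forall v, is_derive v (1 : R) g (dg v)) -> k * u = k' ->
  is_derive t (1 : R) (comb k a b u f g) (comb k' a b u df dg t).
Proof.
move=> fd gd <-.
have d (h dh : R -> R) : (forall v, is_derive v (1 : R) h (dh v)) ->
    is_derive t (1 : R) (fun t => h (u * t)) (u * dh (u * t)).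
  move=> hd; have := is_derive_affine (hd (- u * (0 - t))).
  rewrite (_ : (fun _ => _) = fun t => h (u * t)).
    by rewrite -mulNr opprK sub0r mulrNN.
  by apply/funext => r; congr h; ring.
rewrite (_ : comb _ _ _ _ _ _ =
  k *: (a *: (fun t => f (u * t)) + b *: (fun t => g (u * t))));
  last by apply/funext.
apply: (is_derive_conv (is_deriveZ k (is_deriveD (is_deriveZ a (d _ _ fd))
  (is_deriveZ b (d _ _ gd))))).
by rewrite /GRing.scale/= /comb; ring.
Qed.

Lemma continuous_bounded01 (f : R -> R) : continuous f ->
  exists c : R, forall t, 0 <= t <= 1 -> `|f t| <= c.
Proof.
move=> cf.
have cn : {within `[(0 : R), 1], continuous (fun t => `|f t|)}.
  apply: continuous_subspaceT => t.
  by apply: continuous_comp; [exact: cf|exact: norm_continuous].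
have [c _ fc] := EVT_max ler01 cn.
by exists `|f c| => t t01; apply: fc; rewrite in_itv.
Qed.

(** The values of [J2adj (J2 x)] are integrals of [x], hence see only its
a.e. class: the conclusion holds at every point. *)
Lemma J2adjJ2_ae0 (x : L2 R) (t : R) : x = 0 %[ae mu01 R] ->
  0 <= t <= 1 -> J2adj (J2 x) t = 0.
Proof.
move=> x0 /andP[t0 t1].
have J0 s : J2 (0 : L2 R) s = 0.
  rewrite /= /J2_fun; under eq_Rintegral do rewrite mulr0.
  by rewrite Rintegral_cst// mul0r.
have x0' : x = (0 : L2 R) %[ae mu01 R] by exact: x0.
rewrite /= /J2adj_fun (Defs.ae_itv _ _ _ (J2_ae x0'))//.
- under eq_Rintegral do rewrite J0 mulr0.
  by rewrite Rintegral_cst// mul0r.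
- by move=> s /=; rewrite !in_itv/= => /andP[/(le_trans t0)-> ->].
- exact: measurable_funB.
Qed.

(** The function [beamA u * beamA (u t) - beamE u * beamB (u t)] satisfies the
conditions at 0 because its second and third derivatives involve only [beamC],
[beamE] and [beamB], and its coefficients are chosen so that the slope vanishes
at 1; its value at 1 is the determinant.  It is not a.e. zero, for otherwise its
image would vanish at 0, where it is [u ^- 4 * (2 * beamA u)]. *)
Lemma beam_equation_eigenvalue (u : R) : 0 < u -> cos u * cosh u + 1 = 0 ->
  L2_eigenvalue (fun x : L2 R => J2adj (J2 x)) (u ^- 4).
Proof.
move=> u0 cu; have un0 : u != 0 by rewrite gt_eqF.
have det0 : beamA u ^+ 2 - beamB u * beamE u = 0 by rewrite beam_det cu mulr0.
set a := beamA u in det0; set b := - beamE u.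
pose x := comb 1 a b u beamA beamB.
pose dx := comb u a b u beamE beamA.
pose z := comb (u ^- 2) a b u beamC beamE.
pose dz := comb (u ^- 1) a b u beamB beamC.
pose w := comb (u ^- 4) a b u beamA beamB.
pose dw := comb (u ^- 3) a b u beamE beamA.
have xd t : is_derive t (1 : R) x (dx t).
  by apply: is_derive_comb is_derive_beamA is_derive_beamB _; rewrite mul1r.
have zd t : is_derive t (1 : R) z (dz t).
  by apply: is_derive_comb is_derive_beamC is_derive_beamE _; field.
have dzd t : is_derive t (1 : R) dz (x t).
  by apply: is_derive_comb is_derive_beamB is_derive_beamC _; field.
have wd t : is_derive t (1 : R) w (dw t).
  by apply: is_derive_comb is_derive_beamA is_derive_beamB _; field.
have dwd t : is_derive t (1 : R) dw (z t).
  by apply: is_derive_comb is_derive_beamE is_derive_beamA _; field.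
have cx := is_derive_continuous xd.
have cz := is_derive_continuous zd.
have zE s : 0 <= s <= 1 -> J2_fun x s = z s.
  move=> /andP[s0 _].
  apply: J2_fun_primitive s0 => //; rewrite /z /dz /comb mulr0 !beam0;
    by rewrite !mulr0 addr0 mulr0.
have wE t : 0 <= t <= 1 -> J2adj_fun z t = w t.
  move=> /andP[_ t1].
  apply: J2adj_fun_primitive t1 => //; rewrite /w /dw /comb mulr1 /b -/a.
    rewrite -[RHS](mulr0 (u ^- 4)) -det0; congr (_ * _).
    by rewrite expr2 mulNr [beamE u * _]mulrC.
  by rewrite mulNr [beamE u * _]mulrC subrr mulr0.
have [c xc] := continuous_bounded01 cx.
have mx : measurable_fun setT x by exact: continuous_measurable_fun.
pose X : L2 R := Lfun_Sub (lee1n 2) (Defs.bounded_L2 mx xc).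
have XE t : 0 <= t <= 1 -> J2adj (J2 X) t = u ^- 4 * x t.
  move=> t01; rewrite /x /comb mul1r -/(comb _ _ _ _ _ _ _) -/(w t) -wE//=.
  rewrite /J2adj_fun; apply: eq_Rintegral => s; rewrite inE/= in_itv/=.
  by move=> /andP[ts s1]; rewrite zE// s1 (le_trans _ ts)//; case/andP: t01.
exists X; last first.
  apply: ae_mu01 => t; rewrite in_itv/= => t01 _.
  exact: XE.
move=> X0.
have := XE 0; rewrite lexx ler01 => /(_ isT)/eqP.
rewrite (_ : J2adj (J2 X) 0 = 0).
  rewrite eq_sym mulf_eq0 invr_eq0 expf_eq0/= (negbTE un0)/=.
  rewrite /x /comb mulr0 !beam0 mulr0 addr0 mul1r mulf_eq0 pnatr_eq0 orbF.
  by rewrite gt_eqF// beamA_gt0.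
by apply: J2adjJ2_ae0; rewrite // lexx ler01.
Qed.
End existence.

(** * Continuity, positivity and injectivity *)

Section L2_facts.
Context {R : realType}.
Notation leb := (@lebesgue_measure R).

Lemma lipschitz_kernel_continuous (k : R -> R -> R) (f : R -> R) :
  leb.-integrable setT (EFin \o f) ->
  (forall s, leb.-integrable setT (EFin \o (fun t => k s t * f t))) ->
  (forall s s' t, `|k s t - k s' t| <= `|s - s'|) ->
  continuous (fun s => \int[leb]_t (k s t * f t)).
Proof.
move=> fi ki kl s; set I := \int[leb]_t `|f t|.
have fni : leb.-integrable setT (EFin \o (fun t => `|f t|)).
  by have := integrable_norm fi.
have lip s' : `|\int[leb]_t (k s t * f t) - \int[leb]_t (k s' t * f t)| <=
    `|s - s'| * I.
  rewrite -RintegralB// -RintegralZl//.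
  have di : leb.-integrable setT (EFin \o (fun t => k s t * f t - k s' t * f t)).
    by have := integrableB measurableT (ki s) (ki s').
  apply: (le_trans (le_normr_Rintegral _ di)) => //.
  apply: le_Rintegral => //.
  - by have := integrable_norm di.
  - by have := integrableZl measurableT `|s - s'| fni.
  - by move=> t _; rewrite -mulrBl normrM ler_wpM2r.
have I0 : 0 <= I by apply: Rintegral_ge0.
have I1 : 0 < I + 1 by rewrite ltr_wpDl.
apply/cvgrPdist_le => e e0; near=> s'.
apply: (le_trans (lip s')).
apply: (@le_trans _ _ (e / (I + 1) * I)).
  rewrite ler_wpM2r//.
  near: s'; apply: (@cvgr_dist_le _ _ _ (nbhs s) _ id s cvg_id).
  by rewrite divr_gt0.
by rewrite mulrAC ler_pdivrMr// ler_pM2l// lerDl.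
Unshelve. all: by end_near. Qed.

Lemma hat_kernel_integrable (k : R -> R) (c : R) (x : L2 R) :
  measurable_fun setT k -> (forall t, 0 <= t <= 1 -> `|k t| <= c) ->
  leb.-integrable setT (EFin \o (fun t => k t * Defs.hat x t)).
Proof.
move=> mk kc.
have hx := Defs.hat_integrable x.
have /integrableP[/measurable_EFinP mh _] := hx.
apply: le_integrable (integrableZl _ c hx) => //.
  by apply/measurable_EFinP/measurable_funM.
move=> t _ /=; rewrite lee_fin !normrM.
have [t01|t01] := boolP (t \in `[0, 1]); last first.
  by rewrite Defs.hat0// normr0 !mulr0.
rewrite ler_wpM2r//; apply: le_trans (ler_norm c).
by apply: kc; move: t01; rewrite in_itv.
Qed.

Lemma max0_lip (a b : R) : `|Num.max a 0 - Num.max b 0| <= `|a - b|.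
Proof.
case: (leP a 0) => a0; case: (leP b 0) => b0; rewrite ?subrr ?normr0//.
- by rewrite sub0r normrN gtr0_norm// distrC ger0_norm; lra.
- by rewrite subr0 gtr0_norm// ger0_norm; lra.
Qed.

(** For [s <= 1] this integral is [J2_fun x s]; cutting [x] off outside [[0, 1]],
where it need not be integrable, makes it continuous on the whole line. *)
Lemma J2_kernel_continuous (x : L2 R) :
  continuous (fun s => \int[leb]_t (Num.max (s - t) 0 * Defs.hat x t)).
Proof.
apply: (@lipschitz_kernel_continuous (fun s t => Num.max (s - t) 0)).
- exact: Defs.hat_integrable.
- move=> s; apply: (@hat_kernel_integrable _ (`|s| + 1)).
    by apply: measurable_maxr => //; exact: measurable_funB.
  move=> t /andP[t0 t1]; rewrite /Num.max; case: ifP => _.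
    by rewrite normr0 addr_ge0.
  by rewrite (le_trans (ler_normB _ _))// lerD2l ger0_norm.
- move=> s s' t; apply: (le_trans (max0_lip _ _)).
  by rewrite opprD addrACA subrr addr0.
Qed.

(** The analogue of [J2_kernel_continuous] for [J2adj_fun x t], [0 <= t]. *)
Lemma J2adj_kernel_continuous (x : L2 R) :
  continuous (fun t => \int[leb]_s (Num.max (s - t) 0 * Defs.hat x s)).
Proof.
apply: (@lipschitz_kernel_continuous (fun t s => Num.max (s - t) 0)).
- exact: Defs.hat_integrable.
- move=> s; apply: (@hat_kernel_integrable _ (`|s| + 1)).
    by apply: measurable_maxr => //; exact: measurable_funB.
  move=> t /andP[t0 t1]; rewrite /Num.max; case: ifP => _.
    by rewrite normr0 addr_ge0.
  by rewrite (le_trans (ler_normB _ _))// addrC lerD2l ger0_norm.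
- move=> s s' t; apply: (le_trans (max0_lip _ _)).
  have -> : t - s - (t - s') = s' - s by ring.
  by rewrite distrC.
Qed.

(** A null set contains no ball, and [f] is nonzero on a ball around any point
where it is nonzero. *)
Lemma ae0_continuous (f : R -> R) : {in `]0, 1[, continuous f} ->
  (\forall t \ae mu01 R, f t = 0) -> {in `]0, 1[, forall t, f t = 0}.
Proof.
move=> cf [N [mN N0 fN]] s s01; apply/eqP/negP => /negP fs0.
have : \forall t \near s, f t != 0 /\ t \in `]0, 1[.
  near=> t; split; near: t.
    exact: (cvgr_neq0 (f s) (cf s s01)).
  exact: near_in_itvoo.
move=> /nbhs_ballP[e /= e0 eN].
have : (leb (ball s e) <= mu01 R N)%E.
  rewrite /mu01/= /mrestr; apply: le_measure; rewrite ?inE.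
  - exact: measurable_ball.
  - exact: measurableI.
  - move=> t /eN[ft0 t01]; split; first by apply: fN => /= /eqP; exact/negP.
    by apply: subset_itv_oo_cc t01.
rewrite N0 lebesgue_measure_ball; last exact: ltW.
by rewrite (_ : 0%E = 0%:E)// lee_fin leNgt mulrn_wgt0.
Unshelve. all: by end_near. Qed.

Lemma L2_dot_ge0 (x : L2 R) : 0 <= L2_dot x x.
Proof. by apply: Rintegral_ge0 => t _; rewrite -expr2 sqr_ge0. Qed.

Lemma L2_dot_eq0 (x : L2 R) : L2_dot x x = 0 -> x = 0 %[ae mu01 R].
Proof.
move=> d0.
have xi : (mu01 R).-integrable `[0, 1] (EFin \o (fun t => x t ^+ 2)).
  by apply: integrableS (Lfun2_integrable_sqr (LfunP x)) => //.
have /integrableP[mx _] := xi.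
have : (\int[mu01 R]_(t in `[0%R, 1%R]) `|(x t ^+ 2)%:E|)%E = 0%E.
  under eq_integral do rewrite /= ger0_norm ?sqr_ge0//.
  rewrite -(fineK (integrable_fin_num _ xi))// integral_mu01//.
  by rewrite -[RHS]/((0 : R)%:E) -[in RHS]d0.
move=> i0; have x20 := (ae_eq_integral_abs (mu01 R) (measurable_itv _) mx).1 i0.
have := @ae_mu01 R (fun t => t \in `[0, 1]) (fun _ h => h).
apply: filterS2 x20 => t /= x20 t01 _; have /eqP := x20 t01.
by rewrite eqe expf_eq0/= => /eqP.
Qed.

Lemma ae_lebesgue_mu01 (P : R -> Prop) :
  (\forall t \ae leb, P t) -> \forall t \ae mu01 R, P t.
Proof.
move=> [N [mN N0 PN]]; exists N; split => //.
rewrite /mu01/= /mrestr; apply: subset_measure0 N0 => //.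
exact: measurableI.
Qed.

#[local] Instance mu01_ae_filter : Filter (nbhs (almost_everywhere (mu01 R))).
Proof. exact: ae_filter_ringOfSetsType. Qed.

(** The endpoints 0 and 1 are null, so one may argue in the open interval. *)
Lemma ae_mu01_itvoo (P : R -> Prop) :
  (\forall t \ae mu01 R, t \in `]0, 1[ -> P t) -> \forall t \ae mu01 R, P t.
Proof.
have ne c : \forall t \ae mu01 R, t != c.
  apply: ae_lebesgue_mu01; exists [set c]; split => //.
    exact: lebesgue_measure_set1.
  by move=> t /= /negP; rewrite negbK => /eqP.
have dI := @ae_mu01 R (fun t => t \in `[0, 1]) (fun _ h => h).
move=> h; have n01 := @filterI _ _ mu01_ae_filter _ _ (ne 0) (ne 1).
refine (@filterS3 _ _ mu01_ae_filter _ _ _ _ _ h dI n01) => t /= hP.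
rewrite in_itv/= => /andP[t0 t1] [tn0 tn1].
by apply: hP; rewrite in_itv/= !lt_neqAle eq_sym tn0 t0 tn1.
Qed.

Lemma FTC1_mu01 (f : R -> R) : leb.-integrable setT (EFin \o f) ->
  \forall s \ae mu01 R, (s : R) \in `]0, 1[ ->
    is_derive (s : R) (1 : R) (fun s : R => \int[leb]_(t in `[0, s]) f t) (f s).
Proof.
move=> fi; apply: ae_lebesgue_mu01.
have fi' y : leb.-integrable [set` Interval (BLeft 0) (BRight y)] (EFin \o f).
  exact: integrableS fi.
have := FTC1 fi' (open_integrable_locally openT fi).
apply: filterS; first exact: (ae_filter_ringOfSetsType leb).
move=> s H; rewrite in_itv/= => /andP[s0 _].
have [|dF <-] := H; first by rewrite lte_fin.
by rewrite derive1E; exact: derivableP.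
Qed.

(** Write [J2 x s = s * X s - Y s], where [X] and [Y] integrate [x t] and [t * x t]
from 0.  By Lebesgue differentiation the derivative is a.e.
[X s + s * x s - s * x s = X s].  If [J2 x] vanishes then so does [X], which is
continuous, and then so does [x], the a.e. derivative of [X]. *)
Lemma J2_inj (x : L2 R) : J2 x = 0 %[ae mu01 R] -> x = 0 %[ae mu01 R].
Proof.
move=> zae.
pose hx := Defs.hat x.
have hxi : leb.-integrable setT (EFin \o hx) := Defs.hat_integrable x.
have hyi : leb.-integrable setT (EFin \o (fun t => t * hx t)).
  apply: (@hat_kernel_integrable _ 1) => //.
  by move=> t /andP[t0 t1]; rewrite ger0_norm.
pose X s := \int[leb]_(t in `[0, s]) hx t.
pose Y s := \int[leb]_(t in `[0, s]) (t * hx t).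
have XY s : s \in `]0, 1[ -> J2_fun x s = s * X s - Y s.
  rewrite in_itv/= => /andP[s0 s1]; rewrite /X /Y -RintegralZl//; last first.
    exact: integrableS hxi.
  rewrite -RintegralB//; last 2 first.
  - have := integrableS measurableT _ _ (integrableZl measurableT s hxi).
    by apply.
  - exact: integrableS hyi.
  apply: eq_Rintegral => t; rewrite inE/= in_itv/= => /andP[t0 ts].
  by rewrite /hx Defs.hat1 ?mulrBl// in_itv/= t0 (le_trans ts (ltW s1)).
have z0 s : s \in `]0, 1[ -> J2_fun x s = 0.
  have zK t : t <= 1 -> J2_fun x t = _ := @Defs.J2_funE R x t.
  have cK := @J2_kernel_continuous x.
  have H := @ae0_continuous _ (fun t _ => cK t).
  move=> s01; rewrite zK; last by move: s01; rewrite in_itv/= => /andP[_ /ltW].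
  apply: H s01.
  have dI := @ae_mu01 R (fun t => t \in `[0, 1]) (fun _ h => h).
  refine (@filterS2 _ _ mu01_ae_filter _ _ _ _ zae dI) => t /= zt0.
  rewrite in_itv/= => /andP[_ t1].
  by rewrite -zK//; exact: zt0.
have X'ae := FTC1_mu01 hxi; have Y'ae := FTC1_mu01 hyi.
have X0ae : \forall s \ae mu01 R, X s = 0.
  apply: ae_mu01_itvoo.
  refine (@filterS2 _ _ mu01_ae_filter _ _ _ _ X'ae Y'ae) => s X's Y's s01.
  have dX := X's s01; have dY := Y's s01.
  have d1 : is_derive s (1 : R) (id * X - Y) (X s).
    by apply: is_derive_eq; rewrite /GRing.scale/=; ring.
  have d0 : is_derive s (1 : R) (id * X - Y) 0.
    apply: (@near_eq_is_derive _ _ _ (cst 0)).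
    near=> t; have t01 : t \in `]0, 1[ by near: t; exact: near_in_itvoo.
    by rewrite !fctE -[LHS](z0 t)// XY.
  by rewrite -(@derive_val _ _ _ _ _ _ _ d1) (@derive_val _ _ _ _ _ _ _ d0).
have X0 : {in `]0, 1[, forall s, X s = 0}.
  apply: ae0_continuous X0ae => s s01.
  have xi : leb.-integrable `[0, 1] (EFin \o hx) by exact: integrableS hxi.
  have := parameterized_integral_continuous ler01 xi.
  by move=> /(continuous_within_itvP _ ltr01)[/(_ s s01)].
apply: ae_mu01_itvoo.
refine (@filterS _ _ mu01_ae_filter _ _ _ X'ae) => s X's s01 _.
have dX := X's s01.
have d0 : is_derive s (1 : R) X 0.
  apply: (@near_eq_is_derive _ _ _ (cst 0)).
  near=> t; have t01 : t \in `]0, 1[ by near: t; exact: near_in_itvoo.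
  by rewrite X0.
have : hx s = 0.
  by rewrite -(@derive_val _ _ _ _ _ _ _ dX) (@derive_val _ _ _ _ _ _ _ d0).
by rewrite /hx Defs.hat1//; exact: subset_itv_oo_cc s01.
Unshelve. all: by end_near. Qed.

End L2_facts.

(** * Necessity of the frequency equation *)

Section necessity.
Context {R : realType}.

(** [lam * <x, x> = <J2 x, J2 x>] gives [0 <= lam], and [lam = 0] would put the
eigenvector in the kernel of [J2]. *)
Lemma L2_eigenvalue_gt0 (lam : R) :
  L2_eigenvalue (fun x : L2 R => J2adj (J2 x)) lam -> 0 < lam.
Proof.
move=> [x xn0 Tx].
have dE : L2_dot (J2 x) (J2 x) = lam * L2_dot x x.
  rewrite J2adjP /L2_dot (Defs.ae_itv _ _ (L2_measurable x) Tx)//.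
  rewrite -RintegralZl//.
    by apply: eq_Rintegral => t _; exact: mulrCA.
  have xx : (mu01 R).-integrable `[0, 1] (EFin \o (fun t => x t ^+ 2)).
    by apply: integrableS (Lfun2_integrable_sqr (LfunP x)).
  move: xx => /integrableP[mx xoo]; apply/integrableP; split => //.
  by rewrite -integral_mu01.
have d0 : 0 < L2_dot x x.
  by rewrite lt_neqAle L2_dot_ge0 andbT; apply/eqP => /esym/L2_dot_eq0.
have := L2_dot_ge0 (J2 x); rewrite dE pmulr_lge0// le_eqVlt => /predU1P[l0|//].
by case: xn0; apply/J2_inj/L2_dot_eq0; rewrite dE -l0 mul0r.
Qed.

(** The continuous representative [y] of the eigenvector is integrated four times,
from 0 twice and then from 1 twice; the eigenvalue relation says that the result
[w] is proportional to [y], which is the beam equation with its boundary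
conditions.  If [w] and its slope vanished at 0, so would [w] everywhere. *)
Lemma eigenvalue_beam_equation (u : R) : 0 < u ->
  L2_eigenvalue (fun x : L2 R => J2adj (J2 x)) (u ^- 4) ->
  cos u * cosh u + 1 = 0.
Proof.
move=> u0 [x xn0 Tx]; have un0 : u != 0 by rewrite gt_eqF.
pose y t := u ^+ 4 *
  \int[lebesgue_measure]_s (Num.max (s - t) 0 * Defs.hat (J2 x) s).
have cy : continuous y.
  move=> t; apply: cvgM; first exact: cvg_cst.
  exact: (@J2adj_kernel_continuous _ (J2 x)).
have yE t : 0 <= t <= 1 -> J2adj_fun (J2 x) t = u ^- 4 * y t.
  by move=> /andP[t0 _]; rewrite Defs.J2adj_funE// mulKf// expf_neq0.
have [c yc] := continuous_bounded01 cy.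
have my : measurable_fun setT y by exact: continuous_measurable_fun.
pose Y : L2 R := Lfun_Sub (lee1n 2) (Defs.bounded_L2 my yc).
have xY : x = Y %[ae mu01 R].
  have dI := @ae_mu01 R (fun t => t \in `[0, 1]) (fun _ h => h).
  refine (@filterS2 _ _ mu01_ae_filter _ _ _ _ Tx dI) => t /= Txt.
  rewrite in_itv/= => /yE + _; rewrite Txt// => /(mulfI _); apply.
  by rewrite invr_eq0 expf_neq0.
have J2xY s : 0 <= s <= 1 -> J2_fun x s = J2_fun y s.
  move=> /andP[s0 s1]; apply: (Defs.ae_itv _ _ _ xY) => //.
    by move=> t /=; rewrite !in_itv/= => /andP[-> /le_trans->].
  exact: measurable_funB.
have prim (f : R -> R) (a : R) : continuous f ->
    exists2 F : R -> R, (forall t, is_derive t (1 : R) F (f t)) & F a = 0.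
  move=> /continuous_primitive[F dF]; exists (F - cst (F a)).
    move=> t; have ? := dF t; apply: is_derive_eq.
    by rewrite subr0.
  by rewrite !fctE subrr.
have [z1 dz1 z10] := prim _ 0 cy.
have [z dz z0] := prim _ 0 (is_derive_continuous dz1).
have [w1 dw1 w11] := prim _ 1 (is_derive_continuous dz).
have [w dw w10] := prim _ 1 (is_derive_continuous dw1).
have zE s : 0 <= s <= 1 -> J2_fun x s = z s.
  move=> /[dup] s01 /andP[s0 _]; rewrite J2xY//.
  exact: J2_fun_primitive dz dz1 z0 z10 s0.
have wE t : 0 <= t <= 1 -> y t = u ^+ 4 * w t.
  move=> /[dup] t01 /andP[t0 t1].
  have cz := is_derive_continuous dz.
  rewrite -(J2adj_fun_primitive cz dw dw1 w10 w11 t1).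
  have -> : J2adj_fun z t = J2adj_fun (J2 x) t.
    apply: eq_Rintegral => s; rewrite inE/= in_itv/= => /andP[ts s1].
    by rewrite -zE// s1 (le_trans t0).
  by rewrite yE// mulVKf// expf_neq0.
apply: (beam_characteristic un0 wE dw dw1 dz dz1 z0 z10 w10 w11).
apply/orP; rewrite -negb_and; apply/negP => /andP[/eqP w00 /eqP w100].
apply: xn0; have dI := @ae_mu01 R (fun t => t \in `[0, 1]) (fun _ h => h).
refine (@filterS2 _ _ mu01_ae_filter _ _ _ _ xY dI) => t /= xYt.
rewrite in_itv/= => t01 _; rewrite xYt//= wE//.
have := beam_solution un0 wE dw dw1 dz dz1 z0 z10 t01.
rewrite w00 w100 mulr0 !mul0r addr0 => /eqP.
rewrite !mulf_eq0 pnatr_eq0/= (negbTE un0)/= => /eqP ->.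
by rewrite mulr0.
Qed.

End necessity.

Theorem proposition6 (R : realType) (lambda : R) :
  L2_eigenvalue (fun x : L2 R => J2adj (J2 x)) lambda <->
  0 < lambda /\
  cos (1 / lambda `^ (1 / 4)) * cosh (1 / lambda `^ (1 / 4)) + 1 = 0.
Proof.
have uE : 0 < lambda ->
    0 < 1 / lambda `^ (1 / 4) /\ (1 / lambda `^ (1 / 4)) ^- 4 = lambda.
  move=> l0; split; first by rewrite div1r invr_gt0 powR_gt0.
  rewrite div1r exprVn invrK -powR_mulrn ?powR_ge0// -powRrM.
  by rewrite (_ : 1 / 4 * 4%:R = 1) ?powRr1 ?ltW//; field.
split.
  move=> eig; have l0 := L2_eigenvalue_gt0 eig.
  have [u0 ul] := uE l0; split => //.
  by apply: eigenvalue_beam_equation u0 _; rewrite ul.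
move=> [/uE[u0 ul] cu].
by rewrite -[X in L2_eigenvalue _ X]ul; exact: beam_equation_eigenvalue.
Qed.
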